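(* Let $L\in\mathbb{R}^{\nu\times\nu}[x]$ be a linear pencil, where $x=(x_1,\dots,x_g)$ is a tuple of commuting variables. Let $I\subseteq\mathbb{R}[x]$ be the commutative collapse of $\sqrt[(L)]{\{0\}}$ onto $\mathbb{R}[x]$. (1) $I\subseteq\mathbb{R}[x]$ is an ideal generated by linear polynomials. (2) There exists a linear pencil $\tilde L\in\mathbb{R}^{\nu'\times\nu'}[x]$, where $\nu'\le\nu$, whose positivity set $\{x\in\mathbb{R}^g:\tilde L(x)\succeq0\}$ has nonempty interior, such that $$\{x\in\mathbb{R}^g: L(x)\succeq0\}=\{x\in\mathbb{R}^g:\tilde L(x)\succeq0\text{ and }\iota(x)=0\text{ for each }\iota\in I\}.$$
   Context: A linear pencil in commuting variables is $L=A_0+A_1x_1+\dots+A_gx_g$ with real symmetric $\nu\times\nu$ matrices $A_i$. Here ''linear polynomial'' means a polynomial of degree at most $1$ (constants allowed). Let $\mathbb{R}\langle x,x^*\rangle$ be the free real algebra on the $2g$ noncommuting letters $x_1,\dots,x_g,x_1^*,\dots,x_g^*$, with the linear involution $*$ exchanging $x_i$ and $x_i^*$ and satisfying $(pq)^*=q^*p^*$; on matrices over $\mathbb{R}\langle x,x^*\rangle$ the involution is the transpose combined with the entrywise involution. To the commutative pencil $L$ one associates the pencil $L_0=A_0+\tfrac12\sum_{i=1}^gA_i(x_i+x_i^* )\in\mathbb{R}^{\nu\times\nu}\langle x,x^*\rangle$, which satisfies $L_0(x)=L(x)$ for $x\in\mathbb{R}^g$; $\sqrt[(L)]{\{0\}}$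 means $\sqrt[(L_0)]{\{0\}}\subseteq\mathbb{R}\langle x,x^*\rangle$, defined as follows. A left ideal $J\subseteq\mathbb{R}\langle x,x^*\rangle$ is $L_0$-real if whenever $\sum_i^{\rm finite}p_i^*p_i+\sum_j^{\rm finite}q_j^*L_0q_j\in J+J^*$ with $p_i\in\mathbb{R}\langle x,x^*\rangle$ and $q_j\in\mathbb{R}^{\nu\times1}\langle x,x^*\rangle$, then each $p_i\in J$ and all entries of each $L_0q_j$ lie in $J$. $\sqrt[(L_0)]{\{0\}}$ is the smallest $L_0$-real left ideal (the intersection of all $L_0$-real left ideals). The commutative collapse of $p\in\mathbb{R}\langle x,x^*\rangle$ is the polynomial in $\mathbb{R}[x]$ obtained by letting the variables commute and setting $x_i^*=x_i$; the commutative collapse of a set is the set of collapses of its elements. *)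

(* Defs.v *)
From HB Require Import structures.
From mathcomp Require Import all_boot all_order all_algebra.
From mathcomp Require Import boolp classical_sets reals topology normedtype.
(* The notations of multinomials clash with those of mathcomp-analysis. *)
From mathcomp Require Import -(notations) monalg mpoly.

Set Implicit Arguments.
Unset Strict Implicit.
Unset Printing Implicit Defensive.

Import Order.TTheory GRing.Theory Num.Theory.
Import numFieldNormedType.Exports.

Local Open Scope classical_set_scope.
Local Open Scope ring_scope.

Notation cpoly R g := (mpoly.mpoly g R).

(* The letters are 'I_g + 'I_g: [inl i] is x_i and [inr i] is x_i^*. *)
Notation word g := (monalg.fmonom ('I_g + 'I_g)%type).
Notation ncpoly R g := (monalg.malg (word g) R).

(* For a commutative ring this is the usual notion of ideal; the whole ring is
   allowed. *)
Definition left_ideal (A : nzRingType) (J : set A) : Prop :=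
  [/\ J 0, forall p q, J p -> J q -> J (p + q) & forall a p, J p -> J (a * p)].

Section FreeAlgebra.
Variables (R : realType) (g : nat).
Local Notation A := (ncpoly R g).

Definition ncvar (i : 'I_g) : A :=
  monalg.mkmalgU (monalg.fmu (inl i : 'I_g + 'I_g)) 1.
Definition ncvarstar (i : 'I_g) : A :=
  monalg.mkmalgU (monalg.fmu (inr i : 'I_g + 'I_g)) 1.

Definition letter_star (l : 'I_g + 'I_g) : 'I_g + 'I_g :=
  match l with inl i => inr i | inr i => inl i end.

Definition word_star (w : word g) : word g :=
  monalg.FMonom (rev (map letter_star (monalg.fmonom_val w))).

Definition star (p : A) : A :=
  \sum_(w <- finmap.enum_fset (monalg.msupp p))
    monalg.mkmalgU (word_star w) (monalg.mcoeff w p).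

Definition starmx m n (M : 'M[A]_(m, n)) : 'M[A]_(n, m) := map_mx star M^T.

Definition letter_collapse (l : 'I_g + 'I_g) : cpoly R g :=
  match l with inl i | inr i => mpoly.mpolyX R (mpoly.mnm1 i) end.

Definition collapse (p : A) : cpoly R g :=
  \sum_(w <- finmap.enum_fset (monalg.msupp p))
    monalg.mcoeff w p *: \prod_(l <- monalg.fmonom_val w) letter_collapse l.

Definition add_star (J : set A) : set A :=
  [set u | exists a b, [/\ J a, J b & u = a + star b]].

Definition lreal nu (L0 : 'M[A]_nu) (J : set A) : Prop :=
  forall (ps : seq A) (qs : seq 'cV[A]_nu),
    add_star J (\sum_(p <- ps) star p * p
                + \sum_(q <- qs) (starmx q *m L0 *m q) ord0 ord0) ->
    (forall p, p \in ps -> J p) /\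
    (forall q i, q \in qs -> J ((L0 *m q) i ord0)).

Definition lreal_radical nu (L0 : 'M[A]_nu) (K : set A) : set A :=
  smallest [set J : set A | left_ideal J /\ lreal L0 J] K.

End FreeAlgebra.

Record pencil (R : realType) (g nu : nat) := Pencil {
  pencil_const : 'M[R]_nu;
  pencil_coef : 'I_g -> 'M[R]_nu;
  pencil_const_sym : pencil_const^T = pencil_const;
  pencil_coef_sym : forall i, (pencil_coef i)^T = pencil_coef i
}.

Section Pencil.
Variables (R : realType) (g nu : nat) (L : pencil R g nu).

Definition pencil_eval (x : 'rV[R]_g) : 'M[R]_nu :=
  pencil_const L + \sum_(i < g) x ord0 i *: pencil_coef L i.

Definition nc_pencil : 'M[ncpoly R g]_nu :=
  \matrix_(i, j) ((pencil_const L i j)%:A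
    + 2^-1 *: \sum_(k < g) pencil_coef L k i j *: (ncvar R k + ncvarstar R k)).

Definition psdmx (M : 'M[R]_nu) : Prop :=
  M^T = M /\ forall v : 'cV[R]_nu, 0 <= (v^T *m M *m v) ord0 ord0.

Definition positivity_set : set 'rV[R]_g := [set x | psdmx (pencil_eval x)].

Definition pencil_radical0 : set (ncpoly R g) :=
  lreal_radical nc_pencil [set 0].

Definition pencil_ideal : set (cpoly R g) := @collapse R g @` pencil_radical0.

End Pencil.

Definition linear_poly (R : realType) (g : nat) (p : cpoly R g) : Prop :=
  (mpoly.msize p <= 2)%N. (* [msize] is the degree plus one, and 0 for 0 *)

Definition zero_locus (R : realType) (g : nat) (I : set (cpoly R g)) :
    set 'rV[R]_g :=
  [set x | forall p, I p -> mpoly.meval (fun i => x ord0 i) p = 0].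

(* Main.v *)
Require Import Defs.
From HB Require Import structures.
From mathcomp Require Import all_boot all_order all_algebra.
From mathcomp Require Import boolp classical_sets reals topology normedtype.
From mathcomp Require Import -(notations) monalg mpoly.
From mathcomp Require Import derive ring lra.

Set Implicit Arguments.
Unset Strict Implicit.
Unset Printing Implicit Defensive.

Import Order.TTheory GRing.Theory Num.Theory.
Import numFieldNormedType.Exports.

Local Open Scope classical_set_scope.
Local Open Scope ring_scope.

(** Why the theorem holds.

    Write J for the radical, I for its commutative collapse, P for the
    positivity set of L, and identify an affine form in the symmetric variables
    (x_i + x_i^* ) / 2 with its row of coefficients in R^(1+g).

    Upper bound for I.  At a point x of P, the polynomials whose collapse
    vanishes at x form an L-real left ideal: evaluation at x turns a sum of
    squares plus terms q^* L q into a sum of nonnegative reals.  Hence J lies in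
    all these ideals and I vanishes on P ([radical_vanishes]).

    Lower bound for J.  Let V be the space of affine forms lying in J and
    suppose that 1 is not in J.  Then V avoids the constants, so there is a
    projection E of R^(1+g) that fixes the constant form and has kernel V; it is
    dual to an affine map phi of R^g whose image is the common zero set of V.
    The claim is that L o phi is positive semidefinite on some open box
    ([pull_pencil_interior]).  By a theorem of alternatives for symmetric
    matrices ([gordan_interior]) the only obstruction would be constant row
    vectors u_k, and reals s_k, with sum_k u_k (L o phi) u_k^T + sum_k s_k^2 = 0
    identically, nontrivially.  This says that the affine form
    sum_k u_k L u_k^T + sum_k s_k^2 is in V, hence in J; as J is L-real, it
    contains every s_k and all entries of L u_k^T
    ([radical_constant_certificate]).  So all s_k vanish, and the entries of
    L u_k^T are in V, that is, (L o phi) u_k^T = 0: the obstruction is trivial.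

    Conclusion.  If f is in I then f vanishes on P, which contains the
    phi-image of an open box, so f o phi is the zero polynomial
    ([cpoly_eq0_on_box]) and f = f - f o phi lies in the ideal generated by the
    x_i - phi_i ([comp_mpoly_sub_mem]).  These are collapses of elements of V,
    which gives (1).  For (2) take L' = L o phi, of the same size as L: it agrees
    with L on the zero locus of I because phi is the identity there.  If 1 is in
    J, then I is the unit ideal, P is empty, and the constant identity pencil
    serves as L'. *)

(** * Quadratic forms on matrices and a Gordan alternative *)

Section QuadraticForms.
Variable R : realType.

(** The form u |-> u B u^T summed over the rows u of U, so that one matrix U
    stands for a finite family of row vectors. *)
Definition qform m n (B : 'M[R]_n) (U : 'M[R]_(m, n)) : R :=
  \tr (U *m B *m U^T).

Lemma qformE m n (B : 'M[R]_n) (U : 'M[R]_(m, n)) :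
  qform B U = \sum_i \sum_k (\sum_j U i j * B j k) * U i k.
Proof.
apply: eq_bigr => i _; rewrite mxE; apply: eq_bigr => k _.
by rewrite !mxE.
Qed.

Lemma qform_rows m n (B : 'M[R]_n) (U : 'M[R]_(m, n)) :
  qform B U = \sum_i qform B (row i U).
Proof.
rewrite qformE; apply: eq_bigr => i _.
rewrite qformE big_ord1; apply: eq_bigr => k _.
by rewrite !mxE; congr (_ * _); apply: eq_bigr => j _; rewrite mxE.
Qed.

Lemma qform1E m n (U : 'M[R]_(m, n)) :
  qform 1%:M U = \sum_i \sum_j U i j ^+ 2.
Proof.
rewrite /qform mulmx1; apply: eq_bigr => i _; rewrite mxE.
by apply: eq_bigr => j _; rewrite mxE expr2.
Qed.

Lemma qform1_ge0 m n (U : 'M[R]_(m, n)) : 0 <= qform 1%:M U.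
Proof. by rewrite qform1E; do 2!apply: sumr_ge0 => ? _; apply: sqr_ge0. Qed.

Lemma qform1_eq0 m n (U : 'M[R]_(m, n)) : (qform 1%:M U == 0) = (U == 0).
Proof.
apply/idP/eqP => [|->]; last by rewrite /qform mulmx1 mul0mx linear0.
rewrite qform1E psumr_eq0 => [|i _]; last by apply: sumr_ge0 => ? _; exact: sqr_ge0.
move=> /allP U0; apply/matrixP => i j; rewrite mxE; apply/eqP.
have := U0 i (mem_index_enum _); rewrite psumr_eq0 => [|? _]; last exact: sqr_ge0.
by move=> /allP /(_ j (mem_index_enum _)); rewrite sqrf_eq0.
Qed.

Lemma qformZ m n (B : 'M[R]_n) a (U : 'M[R]_(m, n)) :
  qform B (a *: U) = a ^+ 2 * qform B U.
Proof.
rewrite /qform linearZ /= -scalemxAr -!scalemxAl.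
by rewrite !mxtraceZ expr2 mulrA.
Qed.

Lemma qform_mul m n r (B : 'M[R]_n) (U : 'M[R]_(m, r)) (T : 'M[R]_(r, n)) :
  qform B (U *m T) = qform (T *m B *m T^T) U.
Proof. by rewrite /qform trmx_mul !mulmxA. Qed.

(** The cross terms vanish when z kills U from the left: adding the rank-one
    matrix z^T u to U then has the effect of adjoining a multiple of u as a new
    row, without changing the shape of U. *)
Lemma qform_add_orth m n (B : 'M[R]_n) (U : 'M[R]_(m, n)) (z : 'rV_m) u :
  B^T = B -> z *m U = 0 ->
  qform B (U + z^T *m u) = qform B U + qform 1%:M z * qform B u.
Proof.
move=> Bsym zU; rewrite /qform linearD /= !(mulmxDl, mulmxDr) !linearD /=.
rewrite !trmx_mul trmxK.
have -> : \tr (U *m B *m (u^T *m z)) = 0.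
  by rewrite mulmxA mxtrace_mulC !mulmxA zU !mul0mx linear0.
have -> : \tr (z^T *m u *m B *m U^T) = 0.
  by rewrite -mxtrace_tr !trmx_mul !trmxK !mulmxA mxtrace_mulC !mulmxA zU !mul0mx linear0.
rewrite add0r addr0; congr (_ + _).
rewrite mulmx1 [in LHS]mulmxA mxtrace_mulC !mulmxA.
have -> : z *m z^T *m u *m B *m u^T = (z *m z^T) *m (u *m B *m u^T).
  by rewrite !mulmxA.
by rewrite [z *m _]mx11_scalar mul_scalar_mx mxtraceZ mxtrace_scalar mulr1n.
Qed.

Lemma qform_continuous m n (B : 'M[R]_n) :
  continuous (fun w : 'rV[R]_(m * n) => qform B (vec_mx w : 'M_(m, n))).
Proof.
have vec_cont i j : continuous (fun w : 'rV[R]_(m * n) => (vec_mx w : 'M_(m, n)) i j).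
  rewrite [X in continuous X](_ : _ =
    fun w : 'rV[R]_(m * n) => w ord0 (mxvec_index i j)).
    exact: coord_continuous.
  by apply: funext => w; rewrite mxE.
have sum_cont d (F : 'I_d -> 'rV[R]_(m * n) -> R) :
    (forall i, continuous (F i)) -> continuous (fun w => \sum_i F i w).
  by move=> Fc; apply: continuous_big => // ; exact: add_continuous.
rewrite [X in continuous X](_ : _ = fun w : 'rV[R]_(m * n) => \sum_i \sum_k
    (\sum_j (vec_mx w : 'M_(m, n)) i j * B j k) * (vec_mx w : 'M_(m, n)) i k).
  apply: (sum_cont) => i; apply: (sum_cont) => k w.
  apply: continuousM; last exact: vec_cont.
  apply: (sum_cont) => j {}w; apply: continuousM; first exact: vec_cont.
  exact: cst_continuous.
by apply: funext => w; rewrite qformE.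
Qed.

(** A closed subset of the cube [-1, 1]^(m n). *)
Lemma sphere_compact m n :
  compact [set w : 'rV[R]_(m * n) | qform 1%:M (vec_mx w : 'M_(m, n)) = 1].
Proof.
set A := [set w | _].
have Acl : closed A.
  rewrite (_ : A = (fun w : 'rV[R]_(m * n) => qform 1%:M (vec_mx w : 'M_(m, n)))
                     @^-1` [set x | x = 1]) //.
  apply: preimage_closed; last exact: closed_eq.
  by move=> w _; apply: qform_continuous.
have box := @rV_compact R (m * n) (fun=> `[(-1), 1]%classic)
  (fun=> @segment_compact R (-1) 1).
apply: subclosed_compact Acl box _ => w; rewrite /A /= => w1 k.
have [i [j ->]] : exists i j, k = mxvec_index i j.
  by case/mxvec_indexP: k => i j; exists i, j.
have -> : w ord0 (mxvec_index i j) = (vec_mx w : 'M_(m, n)) i j by rewrite mxE.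
rewrite in_itv /= -ler_norml -(@ler_pXn2r _ 2) ?nnegrE // expr1n.
rewrite real_normK ?num_real // -w1 qform1E (bigD1 i) //= (bigD1 j) //=.
rewrite -addrA lerDl addr_ge0 //; first by apply: sumr_ge0 => ? _; exact: sqr_ge0.
by do 2!apply: sumr_ge0 => ? _; exact: sqr_ge0.
Qed.

Lemma sum_sqrD d (x c : 'I_d -> R) t :
  \sum_b (x b + t * c b) ^+ 2 =
  \sum_b x b ^+ 2 + 2 * t * (\sum_b x b * c b) + t ^+ 2 * (\sum_b c b ^+ 2).
Proof.
rewrite !mulr_sumr -!big_split /=; apply: eq_bigr => b _; ring.
Qed.

(** First-order optimality: divide by t and let t tend to 0. *)
Lemma le_of_quadratic (a b c : R) :
  (forall t, 0 < t -> a * t <= b * t + c * t ^+ 2) -> a <= b.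
Proof.
move=> h; rewrite leNgt; apply/negP => ba.
pose t := (a - b) / (2 * (`|c| + 1)).
have d0 : 0 < 2 * (`|c| + 1) by rewrite mulr_gt0 // ltr_wpDl.
have t0 : 0 < t by rewrite divr_gt0 // subr_gt0.
have tE : t * (2 * (`|c| + 1)) = a - b by rewrite mulfVK // gt_eqF.
have ht : a * t <= b * t + c * t ^+ 2 by apply: h.
have : (a - b) * t <= c * t * t by rewrite mulrBl lerBlDl -mulrA -expr2.
rewrite ler_pM2r // -tE => ct.
have : c * t <= `|c| * t by rewrite ler_wpM2r ?ler_norm // ltW.
have : 0 <= `|c| * t by rewrite mulr_ge0 // ltW.
nra.
Qed.

(** Minimise F(U) = sum_b (qform (B b) U)^2 over the compact unit sphere.  If the
    minimum is 0, the first alternative holds.  Otherwise x_b = qform (B b) U at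
    a minimiser U works: perturbing U in the direction of a rank-one matrix
    z^T u with z U = 0 moves the vector (qform (B b) U)_b along
    (qform (B b) u)_b, so that minimality becomes the asserted inequality with
    e = F(U).  Having n.+1 rows for n columns guarantees that z exists; the set
    of values of (qform (B b) U)_b is therefore as good as convex, with no
    appeal to spectral decompositions or to closures of convex hulls. *)
Lemma gordan_symmetric d n (B : 'I_d -> 'M[R]_n) :
  (forall b, (B b)^T = B b) ->
  (exists2 U : 'M[R]_(n.+1, n), U != 0 & forall b, qform (B b) U = 0) \/
  (exists x : 'I_d -> R, exists2 e, 0 < e &
     forall u : 'rV_n, e * qform 1%:M u <= \sum_b x b * qform (B b) u).
Proof.
move=> Bsym; case: n => [|n] in B Bsym *.
  right; exists (fun=> 0), 1 => // u; rewrite (thinmx0 u) big1 ?(eqP _) //.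
    by move: (qform1_eq0 (0 : 'rV[R]_0)); rewrite eqxx => /eqP ->; rewrite mulr0.
  by move=> b _; rewrite mul0r.
(* One row more than the number n.+1 of columns. *)
set m := n.+2.
pose F (U : 'M[R]_(m, n.+1)) := \sum_b qform (B b) U ^+ 2.
pose A := [set w : 'rV[R]_(m * n.+1) | qform 1%:M (vec_mx w : 'M_(m, n.+1)) = 1].
have A0 : A !=set0.
  exists (mxvec (delta_mx ord0 ord0)); rewrite /A /= mxvecK qform1E.
  rewrite (bigD1 ord0) //= (bigD1 ord0) //= mxE !eqxx expr1n !big1 ?addr0 //.
    by move=> i /negbTE i0; rewrite big1 // => j _; rewrite mxE i0 expr0n.
  by move=> j /negbTE j0; rewrite mxE eqxx j0 expr0n.
have Fcont : continuous (fun w : 'rV[R]_(m * n.+1) => F (vec_mx w)).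
  rewrite /F; apply: continuous_big => [|b _]; first exact: add_continuous.
  have qc := @qform_continuous m n.+1 (B b).
  rewrite [X in continuous X](_ : _ = (fun w : 'rV[R]_(m * n.+1) =>
    qform (B b) (vec_mx w : 'M_(m, n.+1)) * qform (B b) (vec_mx w : 'M_(m, n.+1)))).
    by move=> w; exact: continuousM (qc w) (qc w).
  by apply: funext => w; rewrite expr2.
have [w] := EVT_min_rV A0 (@sphere_compact m n.+1) (continuous_subspaceT Fcont).
rewrite inE /=; set U : 'M_(m, n.+1) := vec_mx w => U1 Umin.
have {Umin}Fge (V : 'M_(m, n.+1)) : F U * qform 1%:M V ^+ 2 <= F V.
  have [->|V0] := eqVneq V 0.
    have /eqP -> : qform 1%:M (0 : 'M[R]_(m, n.+1)) == 0 by rewrite qform1_eq0.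
    by rewrite expr0n mulr0; apply: sumr_ge0 => ? _; exact: sqr_ge0.
  have q0 : 0 < qform 1%:M V by rewrite lt_def qform1_eq0 V0 qform1_ge0.
  pose s := Num.sqrt (qform 1%:M V).
  have s0 : 0 < s by rewrite sqrtr_gt0.
  have sE : s ^+ 2 = qform 1%:M V by rewrite sqr_sqrtr // ltW.
  have sV1 : mxvec (s^-1 *: V) \in A.
    rewrite inE /A /= mxvecK qformZ -sE -exprMn mulVf ?expr1n //.
    by rewrite gt_eqF.
  have := Umin _ sV1; rewrite mxvecK -/U => h.
  rewrite -sE -exprM -ler_pdivlMr ?exprn_gt0 //; apply: le_trans h _.
  rewrite /F mulr_suml le_eqVlt; apply/orP; left; apply/eqP.
  by apply: eq_bigr => b _; rewrite qformZ exprMn -exprM mulrC exprVn.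
have [/eqP|F0] := eqVneq (F U) 0.
  rewrite psumr_eq0 => [/allP FU|? _]; last exact: sqr_ge0.
  left; exists U; first by rewrite -qform1_eq0 U1 oner_eq0.
  by move=> b; apply/eqP; rewrite -sqrf_eq0; apply: FU; exact: mem_index_enum.
right; exists (fun b => qform (B b) U), (F U).
  by rewrite lt_def F0; apply: sumr_ge0 => ? _; exact: sqr_ge0.
move=> u.
have [z z0 zU] : exists2 z : 'rV[R]_m, z != 0 & z *m U = 0.
  have : kermx U != 0.
    rewrite -mxrank_eq0 mxrank_ker -lt0n subn_gt0.
    by rewrite (leq_ltn_trans (rank_leq_col _)).
  move=> /rowV0Pn [z zK z0]; exists z => //; exact/sub_kermxP.
have q0 : 0 < qform 1%:M z by rewrite lt_def qform1_eq0 z0 qform1_ge0.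
set c := fun b => qform (B b) u.
apply: (@le_of_quadratic _ _ ((\sum_b c b ^+ 2 - F U * qform 1%:M u ^+ 2) / 2)).
move=> t t0.
(* Scaled so that the perturbation adds exactly t times the forms of u. *)
pose s := Num.sqrt (t / qform 1%:M z).
have sE : s ^+ 2 * qform 1%:M z = t.
  by rewrite sqr_sqrtr ?divfK ?gt_eqF // ltW // divr_gt0.
have upd C : C^T = C -> qform C (U + z^T *m (s *: u)) = qform C U + t * qform C u.
  by move=> Cs; rewrite qform_add_orth // qformZ mulrA [X in X * _]mulrC sE.
have := Fge (U + z^T *m (s *: u)); rewrite upd ?trmx1 // U1.
rewrite {2}/F (eq_bigr (fun b => (qform (B b) U + t * c b) ^+ 2)); last first.
  by move=> b _; rewrite upd.
rewrite sum_sqrD -/(F U) => h.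
nra.
Qed.

End QuadraticForms.

(** * Projections along a subspace *)

Section Projection.
Variables (F : fieldType) (n : nat) (V : set 'rV[F]_n).
Hypotheses (V0 : V 0) (VD : forall u v, V u -> V v -> V (u + v)).
Hypothesis VZ : forall a v, V v -> V (a *: v).

(** Enlarge a row space inside V until it exhausts V; the rank bounds the number
    of steps. *)
Lemma subspace_row_space : exists M : 'M[F]_n, forall v, V v <-> (v <= M)%MS.
Proof.
suff H k (M : 'M[F]_n) : (n - \rank M <= k)%N -> (forall v, (v <= M)%MS -> V v) ->
    exists M : 'M[F]_n, forall v, V v <-> (v <= M)%MS.
  by apply: (H n 0); [exact: leq_subr | move=> v; rewrite submx0 => /eqP ->].
elim: k M => [|k IH] M rk MV.
all: case: (pselect (exists2 v, V v & ~~ (v <= M)%MS)) => [[v Vv vM]|nV]; last first.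
1,3: exists M => v; split => [Vv|]; last exact: MV.
1,2: by apply: contrapT => /negP vM; apply: nV; exists v.
all: have lt : (\rank M < \rank (M + v)%MS)%N
  by rewrite (ltn_leqif (mxrank_leqif_sup (addsmxSl _ _))) addsmx_sub submx_refl.
  move: rk; rewrite leqn0 subn_eq0 => /leq_ltn_trans /(_ lt).
  by rewrite ltnNge rank_leq_col.
apply: (IH (M + v)%MS).
  by rewrite -ltnS (leq_trans _ rk) // ltn_sub2l // (leq_trans lt) // rank_leq_col.
move=> u /sub_addsmxP [[a b] ->] /=; apply: VD; first by apply: MV; exact: submxMl.
by rewrite [b]mx11_scalar mul_scalar_mx; exact: VZ.
Qed.

Lemma subspace_projection (e : 'rV[F]_n) : (V e -> e = 0) ->
  exists E : 'M[F]_n,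
    [/\ e *m E = e, forall v, V v <-> v *m E = 0 & forall v, V (v - v *m E)].
Proof.
move=> eV; have [M VM] := subspace_row_space.
(* A complement of V that contains e. *)
set U := (e + (M + e)^C)%MS.
have UM0 : (U :&: M = 0)%MS.
  apply/eqP; rewrite -submx0; apply/rV_subP => w.
  rewrite sub_capmx => /andP[/sub_addsmxP [[a b] /= wE] wM].
  have c0 : b *m (M + e)^C%MS = 0.
    apply/eqP; rewrite -submx0 -(capmx_compl (M + e)%MS) sub_capmx submxMl andbT.
    have -> : b *m (M + e)^C%MS = w - a *m e by rewrite wE addrC addKr.
    rewrite addmx_sub // ?(submx_trans wM) ?addsmxSl // eqmx_opp.
    by rewrite (submx_trans (submxMl _ _)) ?addsmxSr.
  move: wE; rewrite c0 addr0 [a]mx11_scalar mul_scalar_mx => wE.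
  have [a0|a0] := eqVneq (a 0 0) 0; first by rewrite wE a0 scale0r sub0mx.
  suff -> : w = 0 by rewrite sub0mx.
  rewrite wE eV ?scaler0 //; apply/VM.
  by move: wM; rewrite wE => /(scalemx_sub (a 0 0)^-1); rewrite scalerA mulVf // scale1r.
have full v : (v <= U + M)%MS.
  apply: submx_full; rewrite -sub1mx (submx_trans (_ : _ <= (M + e) + (M + e)^C)%MS) //.
    by apply: submx_full; exact: addsmx_compl_full.
  rewrite !addsmx_sub addsmxSr /= /U.
  rewrite (submx_trans (addsmxSl e _) (addsmxSl _ _)).
  by rewrite (submx_trans (addsmxSr e _) (addsmxSl _ _)).
exists (proj_mx U M); split.
- by rewrite proj_mx_id // addsmxSl.
- move=> v; split => [/VM vM|v0]; first by rewrite proj_mx_0.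
  by apply/VM; rewrite -[v]subr0 -v0 proj_mx_compl_sub.
- by move=> v; apply/VM; rewrite proj_mx_compl_sub.
Qed.

End Projection.

(** * Interior points of a cone of positive semidefinite pencils *)

Section Interior.
Variable R : realType.

Lemma qform_le_norm n (B : 'M[R]_n) :
  exists2 c, 0 <= c & forall u : 'rV_n, `|qform B u| <= c * qform 1%:M u.
Proof.
exists (\sum_k \sum_j `|B j k|) => [|u]; first by do 2!apply: sumr_ge0 => ? _.
have sq_le j : u ord0 j ^+ 2 <= qform 1%:M u.
  rewrite qform1E big_ord1 (bigD1 j) //= lerDl.
  by apply: sumr_ge0 => ? _; exact: sqr_ge0.
rewrite qformE big_ord1 mulr_suml (le_trans (ler_norm_sum _ _ _)) //.
apply: ler_sum => k _; rewrite !mulr_suml (le_trans (ler_norm_sum _ _ _)) //.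
apply: ler_sum => j _.
rewrite !normrM [X in X * _]mulrC -mulrA ler_wpM2l // -normrM.
move: (sq_le j) (sq_le k) (sqr_ge0 (u ord0 j + u ord0 k)).
move: (sqr_ge0 (u ord0 j - u ord0 k)) => h1 h2 h3 h4.
by rewrite ler_norml; apply/andP; split; nra.
Qed.

(** [gordan_symmetric] applied modulo the common kernel N of the B b: on a
    complement of N the bound by e |u|^2 leaves room for perturbing x, which
    is why the second alternative holds on a whole box. *)
Lemma gordan_interior d n (B : 'I_d -> 'M[R]_n) :
  (forall b, (B b)^T = B b) ->
  (exists m (U : 'M[R]_(m, n)),
     (forall b, qform (B b) U = 0) /\ exists b, U *m B b != 0) \/
  (exists (x : 'I_d -> R) (e : R), 0 < e /\ forall y : 'I_d -> R,
     (forall b, `|y b - x b| < e) ->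
     forall u : 'rV_n, 0 <= \sum_b y b * qform (B b) u).
Proof.
move=> Bsym.
pose N : set 'rV[R]_n := [set v | forall b, v *m B b = 0].
have [||||P [_ NP NsubP]] := @subspace_projection R n N _ _ _ 0.
- by move=> b; rewrite mul0mx.
- by move=> u v Nu Nv b; rewrite mulmxDl Nu Nv addr0.
- by move=> a v Nv b; rewrite -scalemxAl Nv scaler0.
- by [].
have qformP b (u : 'rV_n) : qform (B b) u = qform (B b) (u *m P).
  have uB : u *m B b = u *m P *m B b.
    by apply/eqP; rewrite -subr_eq0 -mulmxBl NsubP.
  have Bu : B b *m u^T = B b *m (u *m P)^T.
    by rewrite -[X in X *m u^T](Bsym b) -trmx_mul uB trmx_mul Bsym.
  by rewrite /qform -[in LHS]mulmxA Bu mulmxA uB.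
have PP : P *m P = P.
  apply/row_matrixP => i; rewrite row_mul rowE.
  by have /NP := NsubP (delta_mx 0 i); rewrite mulmxBl => /subr0_eq <-.
have [T TP Tfree] : exists2 T : 'M[R]_(\rank P, n), (T :=: P)%MS & row_free T.
  by exists (row_base P); [exact: eq_row_base | exact: row_base_free].
have [b|[U U0 UB]|[x [e e0 xe]]] := @gordan_symmetric R d _ (fun b => T *m B b *m T^T).
- by rewrite !trmx_mul trmxK Bsym mulmxA.
- left; exists _, (U *m T); split => [b|]; first by rewrite qform_mul.
  apply: contrapT => nUB; move/eqP: U0; apply.
  have UT_P : U *m T = U *m T *m P.
    have /submxP [X ->] : (U *m T <= P)%MS.
      by rewrite (submx_trans (submxMl _ _)) // TP.
    by rewrite -mulmxA PP.
  have UT0 : U *m T *m P = 0.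
    apply/row_matrixP => i; rewrite row_mul row0; apply/NP => b.
    apply/eqP; apply: contrapT => /negP ne; apply: nUB; exists b.
    apply: contra_neq ne => UTB.
    by rewrite -row_mul UTB row0.
  by apply: (row_free_inj Tfree); rewrite mul0mx UT_P.
right.
have bound b : exists c, 0 <= c /\
    forall u : 'rV_(\rank P), `|qform (T *m B b *m T^T) u| <= c * qform 1%:M u.
  by have [c c0 cle] := qform_le_norm (T *m B b *m T^T); exists c.
have [c cP] := choice bound.
have c0 : 0 < 1 + \sum_b c b by rewrite ltr_pwDl // sumr_ge0 // => b _; case: (cP b).
exists x, (e / (1 + \sum_b c b)); split; first by rewrite divr_gt0.
move=> y yx u.
have /submxP [w uPE] : (u *m P <= T)%MS by rewrite TP submxMl.
rewrite (eq_bigr (fun b => y b * qform (T *m B b *m T^T) w)); last first.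
  by move=> b _; rewrite qformP uPE qform_mul.
have := xe w; set Q := qform 1%:M w => xeQ.
have Q0 : 0 <= Q by exact: qform1_ge0.
have : \sum_b `|(y b - x b) * qform (T *m B b *m T^T) w| <= e * Q.
  apply: (@le_trans _ _ (\sum_b (e / (1 + \sum_b c b) * c b * Q))).
    apply: ler_sum => b _; rewrite normrM -mulrA ler_pM //.
      exact: ltW.
    by have [_ ->] := cP b.
  rewrite -mulr_suml -mulr_sumr ler_wpM2r // -mulrA ger_pMr //.
  by rewrite ler_pdivrMl // mulr1 lerDr.
move: xeQ; rewrite -subr_ge0 => h1 h2.
have -> : \sum_b y b * qform (T *m B b *m T^T) w =
    \sum_b x b * qform (T *m B b *m T^T) w +
    \sum_b (y b - x b) * qform (T *m B b *m T^T) w.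
  by rewrite -big_split /=; apply: eq_bigr => b _; ring.
have h3 := le_trans (ler_norm_sum _ _ _) h2.
have := ler_norm (- (\sum_b (y b - x b) * qform (T *m B b *m T^T) w)).
rewrite normrN; lra.
Qed.

End Interior.

(** * Polynomials vanishing on a box, and substitution modulo an ideal *)

Section CommutativePolynomials.
Variables (R : realType) (g : nat).
Implicit Types (p q : cpoly R g) (x y : 'I_g -> R).

Local Notation var i := (mpolyX R (mnm1 i)).

Lemma cpoly_ind (P : cpoly R g -> Prop) :
  (forall c, P (mpolyC g c)) -> (forall i, P (var i)) ->
  (forall p q, P p -> P q -> P (p + q)) ->
  (forall p q, P p -> P q -> P (p * q)) -> forall p, P p.
Proof.
move=> PC PX PD PM p; have P1 : P 1 by rewrite -mpolyC1; exact: PC.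
rewrite (mpolyE p); elim/big_rec: _ => [|m q _ Pq]; first by rewrite -mpolyC0; exact: PC.
apply: PD Pq; rewrite -mul_mpolyC; apply: (PM _ _ (PC _)).
rewrite mpolyXE_id; elim/big_rec: _ => // i q' _; apply: (PM _ _).
by elim: (m i) => // k IH; rewrite exprS; apply: PM.
Qed.

Let line x i : 'I_g -> {poly R} := fun j => (x j)%:P + (i == j)%:R *: 'X.

Let restrict x i p : {poly R} := mpoly.mmap polyC (line x i) p.

Let restrict_eval x i p t :
  (restrict x i p).[t] = meval (fun j => x j + (i == j)%:R * t) p.
Proof.
elim/cpoly_ind: p => [c|j|p q IHp IHq|p q IHp IHq].
- by rewrite /restrict mpoly.mmapC hornerC mevalC.
- by rewrite /restrict mmapX mmap1U mevalXU /line !hornerE.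
- by rewrite /restrict mmapD hornerD IHp IHq mevalD.
- by rewrite /restrict rmorphM hornerM IHp IHq mevalM.
Qed.

Let restrict_deriv x i p : (restrict x i p)^`().[0] = meval x (mderiv i p).
Proof.
have at0 q : (restrict x i q).[0] = meval x q.
  by rewrite restrict_eval; apply: meval_eq => j; rewrite mulr0 addr0.
elim/cpoly_ind: p => [c|j|p q IHp IHq|p q IHp IHq].
- by rewrite /restrict mpoly.mmapC derivC horner0 mderivC meval0.
- rewrite /restrict mmapX mmap1U /line derivD derivC add0r derivZ derivX.
  rewrite mderivX mnm1E mevalZ hornerZ hornerC eq_sym.
  have [->|_] := eqVneq i j; last by rewrite !mul0r.
  have -> : mnm_sub (mnm1 j) (mnm1 j) = mnm0.
    by apply/mnmP => k; rewrite mnmBE mnm0E subnn.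
  by rewrite mpolyX0 meval1.
- by rewrite /restrict mmapD derivD hornerD -!/(restrict _ _ _) IHp IHq mderivD mevalD.
- rewrite /restrict rmorphM derivM hornerD !hornerM -!/(restrict _ _ _).
  by rewrite !at0 IHp IHq mderivM mevalD !mevalM.
Qed.

(** On the line through y in the i-th direction, p is a univariate polynomial
    with infinitely many zeros, hence zero, and so is its derivative. *)
Lemma mderiv_eq0_on_box x e p i : 0 < e ->
  (forall y, (forall j, `|y j - x j| < e) -> meval y p = 0) ->
  forall y, (forall j, `|y j - x j| < e) -> meval y (mderiv i p) = 0.
Proof.
move=> e0 p0 y yx; rewrite -restrict_deriv.
suff -> : restrict y i p = 0 by rewrite deriv0 horner0.
(* The step d keeps y + t e_i inside the box for 0 <= t < d. *)
pose d := e - `|y i - x i|.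
have d0 : 0 < d by rewrite subr_gt0.
apply: (@roots_geq_poly_eq0 _ _ [seq d / k.+2%:R | k <- iota 0 (size (restrict y i p))]).
- apply/allP => _ /mapP [k _ ->]; apply/rootP; rewrite restrict_eval; apply: p0 => j.
  case: eqP => [<-|_]; last by rewrite mul0r addr0.
  rewrite mul1r addrAC (le_lt_trans (ler_normD _ _)) // -ltrBrDl -/d.
  rewrite ger0_norm ?divr_ge0 ?ltW // ltr_pdivrMr ?ltr0n // -[X in X < _]mulr1.
  by rewrite ltr_pM2l // ltr1n.
- rewrite map_inj_uniq ?iota_uniq // => k l.
  by move=> /(mulfI (lt0r_neq0 d0)) /invr_inj /eqP; rewrite eqr_nat => /eqP [].
- by rewrite size_map size_iota.
Qed.

(** Induction on a bound for the degree: all partial derivatives vanish on the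
    same box, hence are zero, hence p is constant. *)
Lemma cpoly_eq0_on_box x e p : 0 < e ->
  (forall y, (forall i, `|y i - x i| < e) -> meval y p = 0) -> p = 0.
Proof.
move=> e0.
have [k pk] : exists k, forall m, (k <= mdeg m)%N -> mcoeff m p = 0.
  by exists (msize p) => m pm; apply: memN_msupp_eq0; exact: msize_mdeg_ge.
elim: k p pk => [|k IH] p pk p0.
  by apply/mpolyP => m; rewrite mcoeff0 pk.
have dp i : mderiv i p = 0.
  apply: IH => [m km|]; last exact: mderiv_eq0_on_box p0.
  by rewrite mcoeff_deriv pk ?mul0rn // mdegD mpoly.mdeg1 addn1.
have pC : p = mpolyC g (mcoeff mnm0 p).
  apply/mpolyP => m; rewrite mpoly.mcoeffC.
  have [->|m0] := eqVneq m mnm0; first by rewrite mulr1.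
  rewrite mulr0; have [i mi] : exists i, m i != 0%N.
    apply: contrapT => nm; move/eqP: m0; apply; apply/mnmP => i; rewrite mnm0E.
    by apply/eqP; apply: contrapT => /negP mi; apply: nm; exists i.
  have le1 : lem (mnm1 i) m.
    by apply/mnm_lepP => j; rewrite mnm1E; case: eqP => [<-|//]; rewrite lt0n.
  have /eqP := mcoeff_deriv i (mnm_sub m (mnm1 i)) p.
  by rewrite dp mcoeff0 eq_sym mulrn_eq0 /= submK // => /eqP.
have := p0 x; rewrite pC mevalC => p00; rewrite p00 ?mpolyC0 // => i.
by rewrite subrr normr0.
Qed.

(** Modulo K each variable equals the polynomial substituted for it. *)
Lemma comp_mpoly_sub_mem (K : set (cpoly R g)) (l : g.-tuple (cpoly R g)) p :
  left_ideal K -> (forall i, K (var i - tnth l i)) -> K (p - comp_mpoly l p).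
Proof.
move=> [K0 KD KM] Kl; elim/cpoly_ind: p => [c|i|p q IHp IHq|p q IHp IHq].
- by rewrite comp_mpolyC subrr.
- by rewrite comp_mpolyXU -tnth_nth.
- by rewrite comp_mpolyD opprD addrACA; exact: KD.
- rewrite rmorphM.
  have -> : p * q - comp_mpoly l p * comp_mpoly l q =
      q * (p - comp_mpoly l p) + comp_mpoly l p * (q - comp_mpoly l q) by ring.
  by apply: KD; exact: KM.
Qed.

End CommutativePolynomials.

(** * The commutative collapse and the involution *)

Section Collapse.
Variables (R : realType) (g : nat).
Local Notation A := (ncpoly R g).
Implicit Types (p q : A) (c : R) (w : word g).

Definition word_collapse w : cpoly R g :=
  \prod_(l <- monalg.fmonom_val w) letter_collapse R l.

Lemma word_collapse_mmorphism : monalg.mmorphism word_collapse.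
Proof.
split=> [v w|]; last by rewrite /word_collapse fm1 big_nil.
by rewrite /word_collapse fmM big_cat.
Qed.

HB.instance Definition _ :=
  monalg.isMultiplicative.Build (word g) (cpoly R g) word_collapse
    word_collapse_mmorphism.

Lemma collapseE : @collapse R g = monalg.mmap (@mpolyC g R) word_collapse.
Proof. by apply: funext => p; apply: eq_bigr => w _; rewrite mul_mpolyC. Qed.

Lemma collapseD p q : collapse (p + q) = collapse p + collapse q.
Proof. by rewrite collapseE raddfD. Qed.

Lemma collapse_sum I (r : seq I) (F : I -> A) :
  collapse (\sum_(i <- r) F i) = \sum_(i <- r) collapse (F i).
Proof. by rewrite collapseE raddf_sum. Qed.

Lemma collapseM p q : collapse (p * q) = collapse p * collapse q.
Proof. by rewrite collapseE rmorphM. Qed.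

Lemma collapseU c w : collapse (mkmalgU w c) = c *: word_collapse w.
Proof. by rewrite collapseE monalg.mmapU mul_mpolyC. Qed.

Lemma collapseZ c p : collapse (c *: p) = c *: collapse p.
Proof. by rewrite collapseE monalg.mmapZ mul_mpolyC. Qed.

Lemma collapse0 : collapse (0 : A) = 0.
Proof. by rewrite collapseE raddf0. Qed.

Lemma collapse1 : collapse (1 : A) = 1.
Proof. by rewrite collapseE rmorph1. Qed.

Lemma collapse_ncvar (i : 'I_g) : collapse (ncvar R i) = mpolyX R (mnm1 i).
Proof. by rewrite collapseU scale1r /word_collapse fmU big_seq1. Qed.

Lemma collapse_ncvarstar (i : 'I_g) : collapse (ncvarstar R i) = mpolyX R (mnm1 i).
Proof. by rewrite collapseU scale1r /word_collapse fmU big_seq1. Qed.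

Lemma collapse_surj (f : cpoly R g) : exists p, collapse p = f.
Proof.
elim/cpoly_ind: f => [c|i|f1 f2 [p1 <-] [p2 <-]|f1 f2 [p1 <-] [p2 <-]].
- by exists (c *: 1); rewrite collapseZ collapse1 mpoly.alg_mpolyC.
- by exists (ncvar R i); rewrite collapse_ncvar.
- by exists (p1 + p2); rewrite collapseD.
- by exists (p1 * p2); rewrite collapseM.
Qed.

Lemma starE p : star p =
  monalg.mmap (@mkmalgU (word g) R monalg.mone) (fun w => mkmalgU (word_star w) 1) p.
Proof.
apply: eq_bigr => w _; rewrite mul_malgC; apply/malgP => v.
by rewrite monalg.mcoeffZ !monalg.mcoeffU mulrnAr mulr1.
Qed.

Lemma star0 : star (0 : A) = 0.
Proof. by rewrite starE raddf0. Qed.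

Lemma starU c w : star (mkmalgU w c) = mkmalgU (word_star w) c.
Proof.
rewrite starE monalg.mmapU mul_malgC.
by apply/malgP => v; rewrite monalg.mcoeffZ !monalg.mcoeffU mulrnAr mulr1.
Qed.

Lemma star_alg c : star (c%:A : A) = c%:A.
Proof.
rewrite -mul_malgC mulr1 starU; congr mkmalgU.
by apply: val_inj; rewrite /= fm1.
Qed.

Lemma word_collapse_star w : word_collapse (word_star w) = word_collapse w.
Proof.
rewrite /word_collapse /word_star /= (perm_big _ (permEl (perm_rev _))) big_map.
by apply: eq_bigr => -[].
Qed.

Lemma collapse_star p : collapse (star p) = collapse p.
Proof.
rewrite {1}/star collapse_sum; apply: eq_bigr => w _.
by rewrite collapseU word_collapse_star.
Qed.

End Collapse.

(** * Positive semidefinite matrices *)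

Section PositiveSemidefinite.
Variable R : realType.

Lemma qform_sum d m n (c : 'I_d -> R) (B : 'I_d -> 'M[R]_n) (U : 'M[R]_(m, n)) :
  qform (\sum_b c b *: B b) U = \sum_b c b * qform (B b) U.
Proof.
rewrite /qform mulmx_sumr mulmx_suml linear_sum; apply: eq_bigr => b _.
by rewrite /= -scalemxAr -scalemxAl mxtraceZ.
Qed.

Lemma psdmxP n (M : 'M[R]_n) :
  psdmx M <-> M^T = M /\ forall u : 'rV_n, 0 <= qform M u.
Proof.
split=> -[Msym Mge0]; split=> // v.
  by have := Mge0 v^T; rewrite trmxK /qform trace_mx11.
by have := Mge0 v^T; rewrite /qform trmxK trace_mx11.
Qed.

(** Expand the form at v - t M v for small t > 0: the term of first order is
    -2 t |M v|^2, and it must be nonnegative. *)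
Lemma psdmx_ker n (M : 'M[R]_n) (v : 'cV[R]_n) :
  psdmx M -> (v^T *m M *m v) ord0 ord0 = 0 -> M *m v = 0.
Proof.
move=> [Msym Mge0] v0; set w := M *m v.
have wM : v^T *m M = w^T by rewrite trmx_mul Msym.
have ww : (w^T *m w) ord0 ord0 = qform 1%:M w^T.
  by rewrite /qform mulmx1 trmxK trace_mx11.
suff : 2 * qform 1%:M w^T <= 0.
  rewrite pmulr_rle0 // => q0; apply: trmx_inj; rewrite trmx0; apply/eqP.
  by rewrite -qform1_eq0 eq_le q0 qform1_ge0.
apply: (@le_of_quadratic _ _ _ ((w^T *m M *m w) ord0 ord0)) => t t0.
have := Mge0 (v - t *: w).
have -> : (v - t *: w)^T *m M *m (v - t *: w) =
    v^T *m M *m v - t *: (w^T *m w) - t *: (w^T *m w) + t ^+ 2 *: (w^T *m M *m w).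
  have -> : (v - t *: w)^T = v^T - t *: w^T by apply/rowP => i; rewrite !mxE.
  rewrite !(mulmxBl, mulmxBr) -!scalemxAl -!scalemxAr scalerA.
  rewrite wM -!mulmxA -/w -expr2 opprB !addrA.
  by rewrite [LHS]addrAC.
move: v0 ww; move: (v^T *m M *m v) (w^T *m w) (w^T *m M *m w) => X Y Z v0 ww.
rewrite !mxE v0 ww; nra.
Qed.

End PositiveSemidefinite.

(** * Affine forms and homogeneous coordinates *)

Section AffineForms.
Variables (R : realType) (g : nat).

(** Index [ord0] carries the constant term and [lift ord0 i] the i-th variable.
    The same pattern serves for points, variables and matrix coefficients, so
    that affine expressions become plain sums over 'I_g.+1. *)
Definition prepend (T : Type) (t0 : T) (t : 'I_g -> T) (a : 'I_g.+1) : T :=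
  if unlift ord0 a is Some i then t i else t0.

Lemma prepend0 T (t0 : T) t : prepend t0 t ord0 = t0.
Proof. by rewrite /prepend unlift_none. Qed.

Lemma prependS T (t0 : T) t i : prepend t0 t (lift ord0 i) = t i.
Proof. by rewrite /prepend liftK. Qed.

Definition affine_form (V : lmodType R) (t0 : V) (t : 'I_g -> V)
    (v : 'rV[R]_g.+1) : V :=
  \sum_a v ord0 a *: prepend t0 t a.

Lemma affine_form_linear (V : lmodType R) (t0 : V) t : linear (affine_form t0 t).
Proof.
move=> c u v; rewrite /affine_form scaler_sumr -big_split /=.
by apply: eq_bigr => a _; rewrite !mxE scalerDl scalerA.
Qed.

Lemma affine_formE (V : lmodType R) (t0 : V) t v :
  affine_form t0 t v = v ord0 ord0 *: t0 + \sum_i v ord0 (lift ord0 i) *: t i.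
Proof.
rewrite /affine_form big_ord_recl prepend0; congr (_ + _).
by apply: eq_bigr => i _; rewrite prependS.
Qed.

Definition nc_affine : 'rV[R]_g.+1 -> ncpoly R g :=
  affine_form 1 (fun i => 2^-1 *: (ncvar R i + ncvarstar R i)).

Definition cpoly_affine : 'rV[R]_g.+1 -> cpoly R g :=
  affine_form 1 (fun i => mpolyX R (mnm1 i)).

Lemma nc_affineD u v : nc_affine (u + v) = nc_affine u + nc_affine v.
Proof. by rewrite -[u]scale1r /nc_affine affine_form_linear !scale1r. Qed.

Lemma nc_affine0 : nc_affine 0 = 0.
Proof. by rewrite /nc_affine /affine_form big1 // => a _; rewrite mxE scale0r. Qed.

Lemma nc_affineZ c v : nc_affine (c *: v) = c *: nc_affine v.
Proof.
rewrite -[c *: v]addr0 /nc_affine affine_form_linear.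
by rewrite [X in _ + X]nc_affine0 addr0.
Qed.

Lemma nc_affine_sum I (r : seq I) (F : I -> 'rV[R]_g.+1) :
  nc_affine (\sum_(i <- r) F i) = \sum_(i <- r) nc_affine (F i).
Proof. exact: (big_morph _ nc_affineD nc_affine0). Qed.

Lemma nc_affine_const c : nc_affine (c *: delta_mx ord0 ord0) = c%:A.
Proof.
rewrite nc_affineZ /nc_affine affine_formE big1 => [|i _]; last by rewrite mxE scale0r.
by rewrite mxE scale1r addr0.
Qed.

Lemma collapse_nc_affine v : collapse (nc_affine v) = cpoly_affine v.
Proof.
rewrite /nc_affine /cpoly_affine !affine_formE collapseD collapseZ collapse1 collapse_sum.
congr (_ + _); apply: eq_bigr => i _.
rewrite !collapseZ collapseD collapse_ncvar collapse_ncvarstar -mulr2n.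
rewrite -(scaler_nat 2 (mpolyX R _)).
by congr (_ *: _); rewrite scalerA mulVf ?pnatr_eq0 // scale1r.
Qed.

Lemma linear_cpoly_affine v : linear_poly (cpoly_affine v).
Proof.
apply: leq_trans (msize_sum _ _ _) _; apply/bigmax_leqP => a _.
apply: leq_trans (msizeZ_le _ _) _; rewrite /prepend.
by case: unliftP => [i _|_]; rewrite ?msize1 // msizeX mpoly.mdeg1.
Qed.

Definition homogenize (x : 'rV[R]_g) : 'I_g.+1 -> R := prepend 1 (x ord0).

Lemma meval_cpoly_affine (x : 'rV[R]_g) v :
  meval (x ord0) (cpoly_affine v) = \sum_a v ord0 a * homogenize x a.
Proof.
rewrite /homogenize /cpoly_affine affine_formE big_ord_recl prepend0 mulr1.
rewrite mevalD mevalZ meval1 mulr1.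
rewrite raddf_sum; congr (_ + _); apply: eq_bigr => i _.
by rewrite /= mevalZ mevalXU prependS.
Qed.

End AffineForms.

(** * Pencils in homogeneous coordinates *)

Section PencilCoefficients.
Variables (R : realType) (g nu : nat) (L : pencil R g nu).

Definition hcoef : 'I_g.+1 -> 'M[R]_nu := prepend (pencil_const L) (pencil_coef L).

Lemma hcoef_sym a : (hcoef a)^T = hcoef a.
Proof.
rewrite /hcoef /prepend; case: unliftP => [i _|_].
  exact: pencil_coef_sym.
exact: pencil_const_sym.
Qed.

Lemma pencil_evalE x : pencil_eval L x = \sum_a homogenize x a *: hcoef a.
Proof.
rewrite big_ord_recl /homogenize /hcoef !prepend0 scale1r; congr (_ + _).
by apply: eq_bigr => i _; rewrite !prependS.
Qed.

Lemma pencil_eval_sym x : (pencil_eval L x)^T = pencil_eval L x.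
Proof.
rewrite pencil_evalE linear_sum; apply: eq_bigr => a _.
by rewrite linearZ /= hcoef_sym.
Qed.

Lemma nc_pencilE i j : nc_pencil L i j = nc_affine (\row_a hcoef a i j).
Proof.
rewrite mxE /nc_affine affine_formE mxE /hcoef prepend0; congr (_ + _).
rewrite scaler_sumr; apply: eq_bigr => k _.
by rewrite mxE prependS !scalerA mulrC.
Qed.

End PencilCoefficients.

(** * Evaluation at a point of the positivity set *)

Section Evaluation.
Variables (R : realType) (g : nat) (x : 'rV[R]_g).
Local Notation A := (ncpoly R g).

Let ev : {rmorphism A -> R} :=
  meval (x ord0) \o monalg.mmap (@mpolyC g R) (@word_collapse R g).

Let evE p : ev p = meval (x ord0) (collapse p).
Proof. by rewrite collapseE. Qed.

Let ev_star p : ev (star p) = ev p.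
Proof. by rewrite !evE collapse_star. Qed.

Definition vanishing_at : set A := [set p | meval (x ord0) (collapse p) = 0].

Lemma vanishing_at_left_ideal : left_ideal vanishing_at.
Proof.
rewrite /vanishing_at; split => [|p q|a p] /=; rewrite -!evE.
- exact: rmorph0.
- by move=> p0 q0; rewrite rmorphD p0 q0 addr0.
- by move=> p0; rewrite rmorphM p0 mulr0.
Qed.

(** Evaluation at x identifies an element with its star, so it kills [add_star]
    of the ideal, and it sends the left-hand side to a sum of squares and of
    values of the positive semidefinite form L(x); all of them vanish. *)
Lemma vanishing_at_lreal nu (L : pencil R g nu) :
  positivity_set L x -> lreal (nc_pencil L) vanishing_at.
Proof.
move=> Lpsd ps qs [a [b [a0 b0 eqab]]].
have evL : map_mx ev (nc_pencil L) = pencil_eval L x.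
  apply/matrixP => i j; rewrite mxE nc_pencilE evE collapse_nc_affine.
  rewrite meval_cpoly_affine pencil_evalE summxE; apply: eq_bigr => k _.
  by rewrite !mxE mulrC.
have ev_qLq (q : 'cV[A]_nu) : ev ((starmx q *m nc_pencil L *m q) ord0 ord0) =
    ((map_mx ev q)^T *m pencil_eval L x *m map_mx ev q) ord0 ord0.
  have -> : (map_mx ev q)^T = map_mx ev (starmx q).
    by apply/matrixP => i j; rewrite !mxE ev_star.
  by rewrite -evL -!map_mxM [RHS]mxE.
have : ev (\sum_(p <- ps) star p * p
    + \sum_(q <- qs) (starmx q *m nc_pencil L *m q) ord0 ord0) = 0.
  by rewrite eqab rmorphD ev_star !evE a0 b0 addr0.
rewrite rmorphD !rmorph_sum.
have ps_ge0 : 0 <= \sum_(p <- ps) ev (star p * p).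
  by apply: sumr_ge0 => p _; rewrite rmorphM ev_star -expr2 sqr_ge0.
have qs_ge0 : 0 <= \sum_(q <- qs) ev ((starmx q *m nc_pencil L *m q) ord0 ord0).
  by apply: sumr_ge0 => q _; rewrite ev_qLq; case: Lpsd.
move/eqP; rewrite paddr_eq0 // => /andP[].
rewrite psumr_eq0 => [|p _]; last by rewrite rmorphM ev_star -expr2 sqr_ge0.
rewrite psumr_eq0 => [|q _]; last by rewrite ev_qLq; case: Lpsd.
move=> /allP ps0 /allP qs0; split=> [p /ps0|q i /qs0].
  by rewrite rmorphM ev_star -expr2 sqrf_eq0 evE => /eqP.
rewrite ev_qLq => /eqP /(psdmx_ker Lpsd) Lq0.
rewrite /vanishing_at /= -evE.
have -> : ev ((nc_pencil L *m q) i ord0) = map_mx ev (nc_pencil L *m q) i ord0.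
  by rewrite [RHS]mxE.
by rewrite map_mxM evL Lq0 mxE.
Qed.

End Evaluation.

(** * The radical *)

Section Radical.
Variables (R : realType) (g nu : nat) (L : pencil R g nu).
Local Notation A := (ncpoly R g).
Local Notation J := (pencil_radical0 L).

Lemma radical_vanishes x p : positivity_set L x -> J p ->
  meval (x ord0) (collapse p) = 0.
Proof.
move=> xL /(_ (vanishing_at x)); apply; split.
  by split; [exact: vanishing_at_left_ideal | exact: vanishing_at_lreal].
by move=> _ ->; rewrite /vanishing_at /= collapse0 meval0.
Qed.

Lemma radical_left_ideal : left_ideal J.
Proof.
split=> [K [_]|p q Jp Jq K|a p Jp K].
- exact.
- by move=> KJ; case: (KJ) => -[[_ KD _] _] _; apply: KD; [exact: Jp|exact: Jq].
- by move=> KJ; case: (KJ) => -[[_ _ KM] _] _; apply: KM; exact: Jp.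
Qed.

(** Being L-real passes to intersections, because [add_star] is monotone. *)
Lemma radical_lreal : lreal (nc_pencil L) J.
Proof.
move=> ps qs [a [b [Ja Jb eqab]]].
have inK K : [set J : set A | left_ideal J /\ lreal (nc_pencil L) J] K ->
    [set 0] `<=` K -> (forall p, p \in ps -> K p) /\
    (forall q i, q \in qs -> K ((nc_pencil L *m q) i ord0)).
  move=> [Kid Kreal] K0; apply: (Kreal ps qs); exists a, b; split => //.
    exact: (Ja K (conj (conj Kid Kreal) K0)).
  exact: (Jb K (conj (conj Kid Kreal) K0)).
by split=> [p pps K [KC K0]|q i qqs K [KC K0]]; have [Kp Kq] := inK K KC K0;
  [exact: Kp|exact: Kq].
Qed.

Lemma pencil_ideal_left_ideal : left_ideal (pencil_ideal L).
Proof.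
have [J0 JD JM] := radical_left_ideal; split.
- by exists 0 => //; exact: collapse0.
- by move=> _ _ [p Jp <-] [q Jq <-]; exists (p + q); [exact: JD|exact: collapseD].
- move=> f _ [p Jp <-]; have [a <-] := collapse_surj f.
  by exists (a * p); [exact: JM|exact: collapseM].
Qed.

Lemma pencil_ideal_vanishes x f : positivity_set L x -> pencil_ideal L f ->
  meval (x ord0) f = 0.
Proof. by move=> xL [p Jp <-]; exact: radical_vanishes. Qed.

Let constcol (u : 'rV[R]_nu) : 'cV[A]_nu := \col_i (u ord0 i)%:A.

Let mulr_alg (p : A) c : p * c%:A = c *: p.
Proof.
rewrite -mul_malgC mulr1 [p]monalgE mulr_suml scaler_sumr; apply: eq_bigr => w _.
rewrite malgM_def fgmulUU mulm1; apply/malgP => v.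
by rewrite monalg.mcoeffZ !monalg.mcoeffU mulrnAr mulrC.
Qed.

Let nc_pencil_constcol u i :
  (nc_pencil L *m constcol u) i ord0 = nc_affine (\row_a (u *m hcoef L a) ord0 i).
Proof.
rewrite mxE.
rewrite (_ : \row_a _ = \sum_j u ord0 j *: \row_a hcoef L a i j); last first.
  apply/rowP => a; rewrite summxE !mxE; apply: eq_bigr => j _.
  by rewrite !mxE -[in LHS](hcoef_sym L a) mxE.
rewrite nc_affine_sum; apply: eq_bigr => j _.
by rewrite nc_affineZ nc_pencilE mxE mulr_alg.
Qed.

Let constcol_form u :
  (starmx (constcol u) *m nc_pencil L *m constcol u) ord0 ord0 =
  nc_affine (\row_a qform (hcoef L a) u).
Proof.
rewrite -mulmxA mxE.
rewrite (_ : \row_a _ = \sum_i u ord0 i *: \row_a (u *m hcoef L a) ord0 i); last first.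
  apply/rowP => a; rewrite summxE [LHS]mxE /qform trace_mx11 mxE; apply: eq_bigr => j _.
  by rewrite !mxE mulrC.
rewrite nc_affine_sum; apply: eq_bigr => i _.
by rewrite nc_pencil_constcol nc_affineZ !mxE star_alg -scalerAl mul1r.
Qed.

(** The hypothesis is the assertion that
    sum_k u_k L u_k^T + sum_k s_k^2 is in J, where the u_k are the rows of U,
    written coefficient by coefficient; it is an instance of L-realness with
    constant p_k = s_k and q_k = u_k^T. *)
Lemma radical_constant_certificate m (U : 'M[R]_(m, nu)) (s : 'cV[R]_m) :
  J (nc_affine (\row_a (qform (hcoef L a) U + qform 1%:M s * (a == ord0)%:R))) ->
  (forall k, J ((s k ord0)%:A)) /\
  forall k i, J (nc_affine (\row_a (U *m hcoef L a) k i)).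
Proof.
move=> Jw.
pose ps := [seq (s k ord0)%:A : A | k <- enum 'I_m].
pose qs := [seq constcol (row k U) | k <- enum 'I_m].
have [|Jps Jqs] := @radical_lreal ps qs.
  exists (nc_affine (\row_a (qform (hcoef L a) U + qform 1%:M s * (a == ord0)%:R))), 0.
  split=> //; first by case: radical_left_ideal.
  rewrite star0 addr0 !big_map -![Finite.enum _]/(index_enum _) /= addrC.
  rewrite (_ : \row_a _ = \sum_k \row_a qform (hcoef L a) (row k U) +
    \sum_k (s k ord0 ^+ 2) *: delta_mx ord0 ord0); last first.
    apply/rowP => a; rewrite !mxE !summxE qform_rows qform1E mulr_suml.
    congr (_ + _); apply: eq_bigr => k _; first by rewrite mxE.
    by rewrite big_ord1 !mxE.
  rewrite nc_affineD !nc_affine_sum; congr (_ + _); apply: eq_bigr => k _.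
    exact: constcol_form.
  by rewrite nc_affine_const star_alg mulr_alg scalerA expr2.
split=> [k|k i]; first by apply: Jps; apply: map_f; rewrite mem_enum.
rewrite (_ : \row_a _ = \row_a (row k U *m hcoef L a) ord0 i).
  by rewrite -nc_pencil_constcol; apply: Jqs; apply: map_f; rewrite mem_enum.
by apply/rowP => a; rewrite !mxE; apply: eq_bigr => j _; rewrite !mxE.
Qed.

End Radical.

(** * Pulling a pencil back along an affine map *)

Section PullBack.
Variables (R : realType) (g nu : nat) (L : pencil R g nu) (E : 'M[R]_g.+1).
Hypothesis E0 : delta_mx ord0 ord0 *m E = delta_mx ord0 ord0 :> 'rV_g.+1.

Definition pull_coef (b : 'I_g.+1) : 'M[R]_nu := \sum_a E a b *: hcoef L a.

Lemma pull_coef_sym b : (pull_coef b)^T = pull_coef b.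
Proof.
by rewrite linear_sum; apply: eq_bigr => a _; rewrite linearZ /= hcoef_sym.
Qed.

Definition pull_pencil : pencil R g nu :=
  Pencil (pull_coef_sym ord0) (fun i => pull_coef_sym (lift ord0 i)).

Lemma hcoef_pull b : hcoef pull_pencil b = pull_coef b.
Proof.
by case: (unliftP ord0 b) => [i ->|->]; rewrite /hcoef ?prependS ?prepend0.
Qed.

(** The affine map whose matrix in homogeneous coordinates is E; the hypothesis
    on the first row of E says that E preserves the hyperplane of points with
    leading coordinate 1. *)
Definition affine_map (y : 'rV[R]_g) : 'rV[R]_g :=
  \row_i \sum_b E (lift ord0 i) b * homogenize y b.

Lemma homogenize_affine_map y a :
  homogenize (affine_map y) a = \sum_b E a b * homogenize y b.
Proof.
case: (unliftP ord0 a) => [i ->|->]; first by rewrite /homogenize prependS mxE.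
rewrite {1}/homogenize prepend0 (bigD1 ord0) //= big1 => [|b b0].
  move/rowP: E0 => /(_ ord0); rewrite -rowE !mxE eqxx => ->.
  by rewrite /homogenize prepend0 mulr1 addr0.
by move/rowP: E0 => /(_ b); rewrite -rowE !mxE eqxx (negbTE b0) => ->; rewrite mul0r.
Qed.

Lemma pull_pencil_eval y : pencil_eval pull_pencil y = pencil_eval L (affine_map y).
Proof.
rewrite !pencil_evalE.
rewrite (eq_bigr (fun b => \sum_a (E a b * homogenize y b) *: hcoef L a)); last first.
  move=> b _; rewrite hcoef_pull scaler_sumr; apply: eq_bigr => a _.
  by rewrite scalerA mulrC.
rewrite exchange_big; apply: eq_bigr => a _.
by rewrite homogenize_affine_map scaler_suml.
Qed.

Definition affine_subst : g.-tuple (cpoly R g) :=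
  [tuple cpoly_affine (row (lift ord0 i) E) | i < g].

Lemma meval_affine_subst (y : 'rV[R]_g) i :
  meval (y ord0) (tnth affine_subst i) = affine_map y ord0 i.
Proof.
rewrite tnth_mktuple meval_cpoly_affine mxE; apply: eq_bigr => b _.
by rewrite mxE.
Qed.

Lemma var_sub_affine_subst i : mpolyX R (mnm1 i) - tnth affine_subst i =
  cpoly_affine (delta_mx ord0 (lift ord0 i) - delta_mx ord0 (lift ord0 i) *m E).
Proof.
have affB u v : cpoly_affine (u - v) = cpoly_affine u - cpoly_affine v :> cpoly R g.
  by rewrite addrC -scaleN1r /cpoly_affine affine_form_linear scaleN1r addrC.
rewrite tnth_mktuple affB -rowE; congr (_ - _).
rewrite /cpoly_affine affine_formE mxE (negbTE (neq_lift _ _)) scale0r add0r.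
rewrite (bigD1 i) //= mxE !eqxx scale1r big1 ?addr0 // => j ji.
by rewrite mxE (inj_eq (@lift_inj _ ord0)) (negbTE ji) andbF scale0r.
Qed.

End PullBack.

(** * The pencil on the affine hull *)

Section Main.
Variables (R : realType) (g nu : nat) (L : pencil R g nu).
Local Notation J := (pencil_radical0 L).

Let V : set 'rV[R]_g.+1 := [set v | J (nc_affine v)].

Lemma radical_affine_projection : ~ J 1 ->
  exists E : 'M[R]_g.+1,
    [/\ delta_mx ord0 ord0 *m E = delta_mx ord0 ord0 :> 'rV_g.+1,
        forall v, J (nc_affine v) <-> v *m E = 0 &
        forall v, J (nc_affine (v - v *m E))].
Proof.
have [J0 JD JM] := radical_left_ideal L.
move=> nJ1; apply: (@subspace_projection R g.+1 V).
- by rewrite /V /= nc_affine0.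
- by move=> u v; rewrite /V /= nc_affineD; exact: JD.
- by move=> c v; rewrite /V /= nc_affineZ => /(JM c%:A); rewrite -scalerAl mul1r.
- rewrite /V /=; have := @nc_affine_const R g 1; rewrite !scale1r => ->.
  by move/nJ1.
Qed.

(** Apply [gordan_interior] to the pulled back pencil with an extra diagonal
    entry equal to the homogenising coordinate.  In the first alternative the
    extra column yields the reals s_k of a certificate; in the second one the
    extra entry forces x_0 > 0, so that x can be dehomogenised. *)
Lemma pull_pencil_interior (E : 'M[R]_g.+1) : ~ J 1 ->
  delta_mx ord0 ord0 *m E = delta_mx ord0 ord0 :> 'rV_g.+1 ->
  (forall v, J (nc_affine v) <-> v *m E = 0) ->
  exists (x : 'rV[R]_g) (e : R), 0 < e /\
    forall y : 'rV[R]_g, (forall i, `|y ord0 i - x ord0 i| < e) ->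
      positivity_set (pull_pencil L E) y.
Proof.
move=> nJ1 E0 EV.
pose B b : 'M[R]_(nu + 1) := block_mx (pull_coef L E b) 0 0 (b == ord0)%:R%:M.
have BE b m (U : 'M_(m, nu)) (s : 'M_(m, 1)) : qform (B b) (row_mx U s) =
    qform (pull_coef L E b) U + (b == ord0)%:R * qform 1%:M s.
  rewrite /qform tr_row_mx mul_row_block !mulmx0 addr0 add0r mul_row_col linearD /=.
  by congr (_ + _); rewrite mul_mx_scalar -scalemxAl mxtraceZ mulmx1.
have Bsym b : (B b)^T = B b.
  by rewrite /B tr_block_mx !trmx0 tr_scalar_mx pull_coef_sym.
have [[m [W [W0 [b WB]]]]|[x [e [e0 xe]]]] := gordan_interior Bsym.
  exfalso; apply/negP: WB; apply/negPn/eqP.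
  rewrite -[W]hsubmxK; set U := lsubmx W; set s := rsubmx W.
  have {}W0 c : qform (pull_coef L E c) U + (c == ord0)%:R * qform 1%:M s = 0.
    by rewrite -BE hsubmxK.
  have [Js JU] : (forall k, J ((s k ord0)%:A)) /\
      forall k i, J (nc_affine (\row_a (U *m hcoef L a) k i)).
    apply: radical_constant_certificate; apply/EV/rowP => c; rewrite [RHS]mxE -(W0 c).
    rewrite mxE (eq_bigr (fun a => E a c * qform (hcoef L a) U +
        qform 1%:M s * ((a == ord0)%:R * E a c))); last first.
      by move=> a _; rewrite mxE; ring.
    rewrite big_split /= -mulr_sumr [X in _ = _ + X]mulrC /pull_coef qform_sum; congr (_ + _ * _).
    rewrite (bigD1 ord0) // eqxx mul1r big1 => [|a /negbTE ->]; last by rewrite mul0r.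
    by move/rowP: E0 => /(_ c); rewrite -rowE !mxE eqxx /= addr0.
  have s0 : s = 0.
    apply/matrixP => k j; rewrite [j]ord1 [RHS]mxE.
    have [//|sk0] := eqVneq (s k ord0) 0.
    case: nJ1; have [_ _ JM] := radical_left_ideal L.
    have := JM ((s k ord0)^-1)%:A _ (Js k).
    by rewrite -scalerAl mul1r scalerA mulVf // scale1r.
  have U0 : U *m pull_coef L E b = 0.
    apply/matrixP => k i; rewrite [RHS]mxE.
    have : ((\row_a (U *m hcoef L a) k i) *m E) ord0 b = 0.
      by have /EV -> := JU k i; rewrite mxE.
    rewrite mxE => <-; rewrite mulmx_sumr summxE; apply: eq_bigr => a _.
    by rewrite -scalemxAr !mxE mulrC.
  by rewrite s0 mul_row_block U0 !mulmx0 !mul0mx !addr0 row_mx0.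
have x0 : 0 < x ord0.
  (* Moving the coordinate x_0 down by e / 2 keeps it nonnegative. *)
  have := xe (fun b => if b == ord0 then x ord0 - e / 2 else x b) _ (row_mx 0 1%:M).
  have q0 : qform 1%:M (1%:M : 'M[R]_1) = 1 by rewrite /qform trmx1 !mulmx1 mxtrace1.
  have q1 b : qform (pull_coef L E b) (0 : 'rV_nu) = 0 by rewrite /qform !mul0mx linear0.
  rewrite (bigD1 ord0) //= big1 => [|b /negbTE b0]; last first.
    by rewrite BE b0 q1 mul0r addr0 mulr0.
  rewrite BE eqxx q1 q0 add0r mulr1 mulr1 addr0 => h.
  have /h : forall b, `|(if b == ord0 then x ord0 - e / 2 else x b) - x b| < e.
    move=> b; case: eqP => [->|_]; last by rewrite subrr normr0.
    by rewrite addrC addrA addNr add0r normrN gtr0_norm; lra.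
  by lra.
exists (\row_i (x (lift ord0 i) / x ord0)), (e / x ord0); split; first exact: divr_gt0.
(* Box points (1, y) are rescaled by x_0 to lie near x. *)
move=> y yx; apply/psdmxP; split; first exact: pencil_eval_sym.
move=> u; have := xe (fun b => x ord0 * homogenize y b) _ (row_mx u 0).
rewrite (eq_bigr (fun b => x ord0 * (homogenize y b * qform (pull_coef L E b) u))); last first.
  by move=> b _; rewrite BE [qform 1%:M _]/qform !mul0mx linear0 mulr0 addr0 mulrA.
rewrite -mulr_sumr -qform_sum pmulr_rge0 // pencil_evalE => h.
under eq_bigr do rewrite hcoef_pull.
apply: h => b; case: (unliftP ord0 b) => [i ->|->]; last first.
  by rewrite /homogenize prepend0 mulr1 subrr normr0.
rewrite /homogenize prependS; have := yx i; rewrite mxE ltr_pdivlMr // => yxi.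
rewrite (_ : _ - _ = (y ord0 i - x (lift ord0 i) / x ord0) * x ord0); last first.
  by rewrite mulrBl divfK ?gt_eqF // mulrC.
by rewrite normrM (gtr0_norm x0).
Qed.

End Main.

Theorem theorem1p13 (R : realType) (g nu : nat) (L : pencil R g nu) :
  (left_ideal (pencil_ideal L) /\
   exists S : set (cpoly R g),
     (forall s, S s -> linear_poly s) /\
     pencil_ideal L = smallest (@left_ideal _) S) /\
  (exists (nu' : nat) (L' : pencil R g nu'),
     [/\ (nu' <= nu)%N /\ ((0 < nu)%N -> (0 < nu')%N),
         (positivity_set L')° !=set0 &
         positivity_set L = positivity_set L' `&` zero_locus (pencil_ideal L)]).
Proof.
have Iideal := pencil_ideal_left_ideal L.
pose S : set (cpoly R g) := [set s | linear_poly s /\ pencil_ideal L s].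
have S_sub K : S `<=` K -> forall v, pencil_radical0 L (nc_affine v) -> K (cpoly_affine v).
  move=> SK v Jv; apply: SK; split; first exact: linear_cpoly_affine.
  by exists (nc_affine v); last exact: collapse_nc_affine.
have gen : (forall K, left_ideal K -> S `<=` K -> pencil_ideal L `<=` K) ->
    left_ideal (pencil_ideal L) /\ exists S : set (cpoly R g),
     (forall s, S s -> linear_poly s) /\
     pencil_ideal L = smallest (@left_ideal _) S.
  move=> IK; split=> //; exists S; split=> [s []//|]; apply/seteqP; split.
    by move=> f If K [Kid SK]; exact: IK Kid SK f If.
  by move=> f /(_ (pencil_ideal L)); apply; split => // s [].
case: (pselect (pencil_radical0 L 1)) => [J1|nJ1].
  have I1 : pencil_ideal L 1 by exists 1; last exact: collapse1.
  split.
    apply: gen => K [_ _ KM] SK f _; rewrite -[f]mulr1; apply: KM; apply: SK.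
    by split=> //; rewrite /linear_poly msize1.
  have Z0 (i : 'I_g) : (0 : 'M[R]_nu)^T = 0 by rewrite trmx0.
  exists nu, (Pencil (trmx1 R nu) Z0); split=> //.
    exists 0; rewrite (_ : positivity_set _ = setT) ?interiorT //.
    apply/seteqP; split=> // x _; apply/psdmxP; rewrite /pencil_eval /=.
    rewrite big1 ?addr0 => [|i _]; last by rewrite scaler0.
    by split; [exact: trmx1|move=> u; exact: qform1_ge0].
  apply/seteqP; split=> x.
    move=> xL; have /eqP := pencil_ideal_vanishes xL I1.
    by rewrite meval1 oner_eq0.
  by move=> [_ /(_ _ I1) /eqP]; rewrite meval1 oner_eq0.
have [E [E0 EV EVsub]] := radical_affine_projection nJ1.
have [x [e [e0 xe]]] := pull_pencil_interior nJ1 E0 EV.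
split.
  apply: gen => K Kid SK f If.
  have subst0 : comp_mpoly (affine_subst E) f = 0.
    apply: (@cpoly_eq0_on_box _ _ (x ord0) e) => // y yx.
    pose yv : 'rV[R]_g := \row_i y i.
    have yvE : y = yv ord0 by apply: funext => i; rewrite mxE.
    rewrite yvE comp_mpoly_meval.
    rewrite (meval_eq _ (v2 := affine_map E yv ord0)); last first.
      by move=> i; exact: meval_affine_subst.
    apply: pencil_ideal_vanishes If; rewrite /positivity_set /=.
    rewrite -pull_pencil_eval //; apply: xe => i.
    by rewrite -yvE.
  rewrite -[f]subr0 -subst0; apply: comp_mpoly_sub_mem => // i.
  rewrite var_sub_affine_subst; exact: S_sub SK _ (EVsub _).
exists nu, (pull_pencil L E); split=> //.
  exists x; apply/nbhs_ballP; exists e => //= y [_ xy]; apply: xe => i.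
  by rewrite distrC; exact: xy.
have on_locus y : zero_locus (pencil_ideal L) y -> affine_map E y = y.
  move=> Zy; apply/rowP => i; apply/eqP; rewrite eq_sym -subr_eq0.
  rewrite -meval_affine_subst -(mevalXU (y ord0) i) -mevalB var_sub_affine_subst.
  by apply/eqP/Zy; exact: S_sub (fun s => @proj2 _ _) _ (EVsub _).
apply/seteqP; split=> y.
  move=> yL; have Zy : zero_locus (pencil_ideal L) y.
    by move=> f; exact: pencil_ideal_vanishes.
  by split=> //; rewrite /positivity_set /= pull_pencil_eval // on_locus.
by move=> [yL' Zy]; move: yL'; rewrite /positivity_set /= pull_pencil_eval // on_locus.
Qed.
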